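(* Let $\mathcal H$ be a complex Hilbert space of finite dimension $d\ge 2$, and let $w$ be a context-indexed probability assignment on $\mathfrak M_1(\mathcal H)$. Let $P$ be a rank-one orthogonal projection on $\mathcal H$ and put $n=d-1$. Then $$\operatorname{osc}^{\max}_P(w)\le\binom{n}{2}\operatorname{def}^{(2)}_P(w).$$ Therefore, on maximal measurements, invariance under all two-level complementary unitaries (i.e. $w(P,U\mathsf MU^* )=w(P,\mathsf M)$ for every rank-one $P$, every $\mathsf M\in\mathfrak M_{1,P}$ and every $U\in G_P^{(2)}$) is equivalent to full complementary-unitary invariance and to context independence.
   Context: A projective measurement on $\mathcal H$ is an unordered finite family (set) $\mathsf M=\{P_1,\dots,P_m\}$ of nonzero pairwise orthogonal orthogonal projections on $\mathcal H$ with $\sum_{j=1}^m P_j=I$; it is maximal if every $P_j$ has rank one. $\mathfrak M_1(\mathcal H)$ is the set of maximal projective measurements, and for rank-one $P$, $\mathfrak M_{1,P}=\{\mathsf M\in\mathfrak M_1(\mathcal H):P\in\mathsf M\}$. A context-indexed probability assignment on $\mathfrak M_1(\mathcal H)$ is a function $w:\{(P,\mathsf M):\mathsf M\in\mathfrak M_1(\mathcal H),\ P\in\mathsf M\}\to[0,1]$ with $\sum_{P\in\mathsf M}w(P,\mathsf M)=1$ for every $\mathsf M\in\mathfrak M_1(\mathcal H)$. It is context independent if $w(P,\mathsf M)=w(P,\mathsf N)$ whenever $P\in\mathsf M\cap\mathsf N$. $G_P=\{U\in\mathcal U(\mathcal H):Ux=x\text{ for every }x\in\operatorname{ran}P\}$,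 where $\mathcal U(\mathcal H)$ is the unitary group, and $U\mathsf M U^*:=\{UQU^*:Q\in\mathsf M\}$. The assignment $w$ is (fully) complementary-unitary invariant if $w(P,U\mathsf MU^* )=w(P,\mathsf M)$ for every $\mathsf M\in\mathfrak M_1(\mathcal H)$, every $P\in\mathsf M$ and every $U\in G_P$. Write $P^\perp=\operatorname{ran}(I-P)$. For rank-one $P$, $U\in G_P$ is called two-level if there is a subspace $L\subseteq P^\perp$ with $\dim L\le 2$ such that $U$ is the identity on $P^\perp\ominus L$ (the orthogonal complement of $L$ in $P^\perp$). $G_P^{(2)}$ is the set of two-level elements of $G_P$. Define $$\operatorname{def}^{(2)}_P(w)=\sup_{\mathsf M\in\mathfrak M_{1,P},\,U\in G_P^{(2)}}|w(P,U\mathsf MU^* )-w(P,\mathsf M)|,\qquad \operatorname{osc}^{\max}_P(w)=\sup_{\mathsf M,\mathsf N\in\mathfrak M_{1,P}}|w(P,\mathsf M)-w(P,\mathsf N)|.$$ *)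

(* Defs.v *)
From HB Require Import structures.
From mathcomp Require Import all_boot all_order all_algebra.
From mathcomp Require Import finmap complex.
From mathcomp Require Import boolp classical_sets reals.

Set Implicit Arguments.
Unset Strict Implicit.
Unset Printing Implicit Defensive.

Import Order.TTheory GRing.Theory Num.Theory.
Local Open Scope fset_scope.
Local Open Scope classical_set_scope.
Local Open Scope ring_scope.

(* A complex Hilbert space of finite dimension is a [vectType R[i]] equipped  *)
(* with a positive definite hermitian form, linear in its first argument.     *)
Section Operators.
Variables (R : realType) (H : vectType R[i]) (dot : {dot H for Num.conj}).
Implicit Types A B P Q U : 'End(H).

Definition is_adjoint A B : Prop := forall x y, dot (A x) y = dot x (B y).

Lemma is_adjoint_inj A B B' : is_adjoint A B -> is_adjoint A B' -> B = B'.
Proof.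
move=> AB AB'; apply/lfunP => y; apply/eqP; rewrite -subr_eq0 -(dnorm_eq0 dot).
by rewrite linearBr /= -AB -AB' subrr.
Qed.

Lemma orthonormal_exists (k : nat) : (k <= \dim {:H})%N ->
  exists2 s : seq H, size s = k & orthonormal dot s.
Proof.
elim: k => [|k IHk] kH; first by exists [::].
have [s ss os] := IHk (ltnW kH).
have /subvPn[v _ vs] : ~~ (fullv <= <<s>>)%VS.
  by apply/negP => /dimvS; rewrite leqNgt (leq_ltn_trans (dim_span s)) ?ss.
have [X Xs [Y [Ev _ Ys]]] := orthogonal_split dot s v.
have Y0 : Y != 0.
  by apply: contra vs => /eqP Y0; rewrite Ev Y0 addr0.
have c0 : sqrtC (dot Y Y) != 0 by rewrite sqrtC_eq0 dnorm_eq0.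
exists ((sqrtC (dot Y Y))^-1 *: Y :: s); first by rewrite /= ss.
rewrite -cat1s orthonormal_cat os /=; apply/andP; split.
  rewrite /orthonormal /= !andbT dnormZ normfV ger0_norm ?sqrtC_ge0 ?dnorm_ge0 //.
  by rewrite exprVn sqrtCK mulVf // dnorm_eq0.
apply/orthoPl => u us; rewrite linearZl_LR /=.
by move/orthoPl: Ys => ->; rewrite ?mulr0.
Qed.

Lemma adjoint_exists A : exists B, is_adjoint A B.
Proof.
have [s ss os] := orthonormal_exists (leqnn _).
have fs : <<s>>%VS = fullv.
  by apply/eqP; rewrite eqEdim subvf -ss (eqP (orthonormal_free os)) /=.
have [us oo] := orthonormalP os.
pose f (y : H) : H := \sum_(e <- s) dot y (A e) *: e.
have lf : linear f.
  move=> a x y; rewrite /f scaler_sumr -big_split /=; apply: eq_bigr => e _.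
  by rewrite linearPl scalerDl scalerA.
pose F := GRing.isLinear.Build _ _ _ _ f lf.
pose f' : {linear H -> H} := HB.pack f F.
exists (linfun f') => x y; rewrite lfunE /= /f.
suff : forall z, z \in <<s>>%VS -> dot (A z) y = dot z (f y).
  by apply; rewrite fs memvf.
move=> z /(coord_span (X := in_tuple s)) ->.
rewrite linear_sum !linear_sumlz /=; apply: eq_bigr => i _.
rewrite linearZ /= !linearZl_LR /=; congr (_ * _).
have si : s`_i \in s by rewrite mem_nth.
rewrite raddf_sum (bigD1_seq (s`_i)) //= big1_seq ?addr0 => [|e /andP[ne es]].
  by rewrite linearZr_LR /= (oo _ _ si si) eqxx mulr1 (hermC dot) /= mul1r.
by rewrite linearZr_LR /= (oo _ _ si es) eq_sym (negPf ne) mulr0.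
Qed.

Definition adj A : 'End(H) := xget 0 [set B | is_adjoint A B].

Lemma adjP A x y : dot (A x) y = dot x (adj A y).
Proof.
by have [B AB] := adjoint_exists A; exact: (@xgetPex _ 0 _ (ex_intro _ B AB)).
Qed.

Definition is_oproj P : Prop := (P \o P)%VF = P /\ adj P = P.

Definition is_rank_one_proj P : Prop := is_oproj P /\ \dim (limg P) = 1%N.

Definition is_unitary U : Prop :=
  (adj U \o U)%VF = \1%VF /\ (U \o adj U)%VF = \1%VF.

Implicit Types M N : {fset 'End(H)}.

Definition is_proj_measurement M : Prop :=
  [/\ forall P, P \in M -> is_oproj P /\ P != 0,
      forall P Q, P \in M -> Q \in M -> P != Q -> (P \o Q)%VF = 0
    & \sum_(P <- M) P = \1%VF].

Definition is_max_measurement M : Prop :=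
  is_proj_measurement M /\ forall P, P \in M -> \dim (limg P) = 1%N.

Definition max_meas_at P : set {fset 'End(H)} :=
  [set M | is_max_measurement M /\ P \in M].

Definition conj_meas U M : {fset 'End(H)} := [fset (U \o Q \o adj U)%VF | Q in M].

Definition stab P : set 'End(H) :=
  [set U | is_unitary U /\ forall x, x \in limg P -> U x = x].

Definition ran_perp P : {vspace H} := limg (\1%VF - P).

Definition two_level_stab P : set 'End(H) :=
  [set U | stab P U /\
     exists L : {vspace H},
       [/\ (L <= ran_perp P)%VS, (\dim L <= 2)%N
         & forall x, x \in (ran_perp P :&: orthov dot L)%VS -> U x = x]].

(* An assignment is a total function [w P M]; only its values at pairs with M *)
(* a maximal measurement and P \in M are ever constrained or used.            *)
Implicit Type w : 'End(H) -> {fset 'End(H)} -> R.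

Definition is_assignment w : Prop := forall M, is_max_measurement M ->
  (forall P, P \in M -> 0 <= w P M <= 1) /\ \sum_(P <- M) w P M = 1.

Definition context_independent w : Prop :=
  forall M N P, is_max_measurement M -> is_max_measurement N ->
    P \in M -> P \in N -> w P M = w P N.

Definition unitary_invariant w : Prop :=
  forall M P U, is_max_measurement M -> P \in M -> stab P U ->
    w P (conj_meas U M) = w P M.

Definition two_level_invariant w : Prop :=
  forall P M U, is_rank_one_proj P -> max_meas_at P M -> two_level_stab P U ->
    w P (conj_meas U M) = w P M.

(* The real [sup]s below are over nonempty sets bounded by 1 as soon as w is  *)
(* an assignment and P a rank-one projection.                                 *)
Definition def2 P w : R :=
  sup [set r | exists M U, [/\ max_meas_at P M, two_level_stab P U
                             & r = `|w P (conj_meas U M) - w P M|]].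

Definition osc_max P w : R :=
  sup [set r | exists M N, [/\ max_meas_at P M, max_meas_at P N
                             & r = `|w P M - w P N|]].

End Operators.

(* Main.v *)
(** A maximal measurement is the set of the projections |e><e|, for e in an
orthonormal basis, so two such measurements M, N containing P = |p><p| are two
bases through p.  Given a unit vector f orthogonal to p, a basis
p, e_1, ..., e_n can be changed into one containing p and f by n - 1 two-level
rotations: write f = <f, e_1> e_1 + k g with g a unit vector in the span of
e_2, ..., e_n, bring g into the basis by induction, then rotate the plane
spanned by e_1 and g.  Doing this for the successive vectors f of N costs
(n - 1) + ... + 1 + 0 = C(n, 2) rotations, each of which changes w(P, .) by at
most def2.  With 0 in place of def2 the same chain gives the equivalences. *)

Require Import Defs.
From HB Require Import structures.
From mathcomp Require Import all_boot all_order all_algebra.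
From mathcomp Require Import finmap complex.
From mathcomp Require Import boolp classical_sets reals.
From mathcomp Require Import ring lra.
Import Order.TTheory GRing.Theory Num.Theory.
Local Open Scope ring_scope.

Set Implicit Arguments.
Unset Strict Implicit.
Unset Printing Implicit Defensive.

(** * Rank-one operators |a><b| and rank-one projections *)

Section RankOne.
Variables (R : realType) (H : vectType R[i]) (dot : {dot H for Num.conj}).
Implicit Types (a b e f g p x y : H) (r s t : seq H).

Definition ketbra_fun a b x : H := dot x b *: a.

Fact ketbra_fun_linear a b : linear (ketbra_fun a b).
Proof. by move=> k x y; rewrite /ketbra_fun linearPl scalerDl scalerA. Qed.

HB.instance Definition _ a b :=
  GRing.isLinear.Build _ _ _ _ (ketbra_fun a b) (ketbra_fun_linear a b).

Definition ketbra a b : 'End(H) := linfun (ketbra_fun a b).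

Lemma ketbraE a b x : ketbra a b x = dot x b *: a.
Proof. by rewrite lfunE. Qed.

Lemma dotC x y : dot x y = (dot y x)^*.
Proof. by rewrite (hermC dot) expr0 mul1r. Qed.

Lemma dotBl x y z : dot (x - y) z = dot x z - dot y z.
Proof. exact: linearBl. Qed.

Lemma dotBr x y z : dot x (y - z) = dot x y - dot x z.
Proof. exact: linearBr. Qed.

Lemma dotDl x y z : dot (x + y) z = dot x z + dot y z.
Proof. exact: linearDl. Qed.

Lemma dotDr x y z : dot x (y + z) = dot x y + dot x z.
Proof. exact: linearDr. Qed.

Lemma dotZl k x y : dot (k *: x) y = k * dot x y.
Proof. exact: linearZl_LR. Qed.

Lemma dotZr k x y : dot x (k *: y) = k^* * dot x y.
Proof. exact: linearZr_LR. Qed.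

Lemma dot0l x : dot 0 x = 0.
Proof. exact: linear0l. Qed.

Lemma dot_inj x y : (forall z, dot z x = dot z y) -> x = y.
Proof.
by move=> E; apply/eqP; rewrite -subr_eq0 -(dnorm_eq0 dot) dotBr E subrr.
Qed.

Lemma adjE (A : 'End(H)) x y : dot (adj dot A x) y = dot x (A y).
Proof. by rewrite dotC -adjP -dotC. Qed.

Lemma adj_ketbra a b : adj dot (ketbra a b) = ketbra b a.
Proof.
apply/lfunP => x; apply: dot_inj => z.
by rewrite -adjP !ketbraE dotZl dotZr mulrC -dotC.
Qed.

Lemma ketbra_conj (U : 'End(H)) a b :
  (U \o ketbra a b \o adj dot U)%VF = ketbra (U a) (U b).
Proof.
by apply/lfunP => x; rewrite !comp_lfunE !ketbraE adjE linearZ.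
Qed.

Lemma unit_neq0 p : dot p p = 1 -> p != 0.
Proof. by move=> p1; rewrite -(dnorm_eq0 dot) p1 oner_eq0. Qed.

Lemma normalize g : g != 0 -> exists2 k : R[i], 0 < k &
  dot (k^-1 *: g) (k^-1 *: g) = 1.
Proof.
move=> g0; exists (sqrtC (dot g g)); first by rewrite sqrtC_gt0 dnorm_gt0.
rewrite dnormZ normfV ger0_norm ?sqrtC_ge0 ?dnorm_ge0 //.
by rewrite exprVn sqrtCK mulVf // dnorm_eq0.
Qed.

(** The two occurrences of the scalar combine to |k|^2, so a projection does not see the phase of
    its unit vector. *)
Lemma ketbra_phase k p : `|k| = 1 -> ketbra (k *: p) (k *: p) = ketbra p p.
Proof.
move=> k1; apply/lfunP => x.
rewrite !ketbraE dotZr scalerA -mulrA mulrCA [_^* * _]mulrC.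
by rewrite -normCK k1 expr1n mulr1.
Qed.

Lemma limg_ketbra p : dot p p = 1 -> limg (ketbra p p) = <[p]>%VS.
Proof.
move=> p1; apply/eqP; rewrite eqEsubv; apply/andP; split.
  by apply/subvP => _ /memv_imgP[x _ ->]; rewrite ketbraE memvZ ?memv_line.
by rewrite -memvE; apply/memv_imgP; exists p; rewrite ?memvf // ketbraE p1 scale1r.
Qed.

Lemma rank_one_ketbra p : dot p p = 1 -> is_rank_one_proj dot (ketbra p p).
Proof.
move=> p1; split; last by rewrite limg_ketbra // dim_vline unit_neq0.
split; last by rewrite adj_ketbra.
by apply/lfunP => x; rewrite comp_lfunE !ketbraE dotZl p1 mulr1.
Qed.

(** Here [p] is a normalized vector of the one-dimensional range; it is fixed by [P] because [P] is
    idempotent. *)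
Lemma rank_oneP (P : 'End(H)) : is_rank_one_proj dot P ->
  exists2 p, dot p p = 1 & P = ketbra p p.
Proof.
move=> [[PP aP] dP].
have : limg P != 0%VS by rewrite -dimv_eq0 dP.
rewrite -vpick0.
set g := vpick _ => g0; have gP : g \in limg P by exact: memv_pick.
have [k k0 p1] := normalize g0; set p := k^-1 *: g in p1 *.
have pP : p \in limg P by rewrite memvZ.
exists p => //; apply/lfunP => x; rewrite ketbraE.
have Ep : limg P = <[p]>%VS.
  apply/eqP; rewrite eq_sym eqEdim -memvE pP dP dim_vline unit_neq0 //.
have /vlineP[c Ec] : P x \in <[p]>%VS by rewrite -Ep memv_img ?memvf.
have /memv_imgP[u _ Eu] := pP.
have Pp : P p = p by rewrite Eu -comp_lfunE PP.
(* Self-adjointness: <x, p> = <x, P p> = <P x, p> = c. *)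
have -> : dot x p = c.
  by rewrite -{1}Pp -[in X in dot x X]aP -adjP Ec dotZl p1 mulr1.
by [].
Qed.

(** * Orthonormal bases and unitaries *)

Definition onb s := orthonormal dot s /\ size s = \dim {:H}.

Lemma onb_perm s t : perm_eq s t -> onb s -> onb t.
Proof.
by move=> st [os ss]; split; [rewrite -(eq_orthonormal dot st)|rewrite -(perm_size st)].
Qed.

Lemma onb_span s : onb s -> <<s>>%VS = fullv.
Proof.
case=> os ss; apply/eqP; rewrite eqEdim subvf /= -ss.
by rewrite (eqP (orthonormal_free os)).
Qed.

Lemma onb_ortho0 s x : onb s -> (forall e, e \in s -> dot x e = 0) -> x = 0.
Proof.
move=> os xs; apply/eqP; rewrite -(dnorm_eq0 dot); apply/eqP.
apply: (@span_orthogonal _ _ dot [:: x] s); rewrite ?memv_span1 //.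
  by apply/orthoPl.
by rewrite onb_span ?memvf.
Qed.

Lemma onb_expand s x : onb s -> x = \sum_(e <- s) dot x e *: e.
Proof.
move=> os; apply/eqP; rewrite -subr_eq0; apply/eqP; apply: onb_ortho0 (os) _ => e es.
have [/orthonormalP[us oo] _] := os.
rewrite dotBl linear_sumlz (bigD1_seq e) //= big1_seq => [|f /andP[fe fs]].
  by rewrite dotZl [dot e e]oo // eqxx mulr1 addr0 subrr.
by rewrite dotZl [dot f e]oo // (negPf fe) mulr0.
Qed.

Lemma onb_in s e f : onb s -> e \in s -> f \in s -> dot e f = (e == f)%:R.
Proof. by case=> /orthonormalP[_ oo] _ es fs; exact: oo. Qed.

Lemma orthonormal_cons e s : orthonormal dot (e :: s) <->
  [/\ dot e e = 1, orthonormal dot s & forall f, f \in s -> dot e f = 0].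
Proof.
rewrite -cat1s orthonormal_cat {1}/orthonormal /= !andbT.
split=> [/and3P[/eqP ee os /allP oe]|[-> -> oe]].
  by split=> // f fs; apply/eqP/oe.
by apply/and3P; split=> //; apply/allP => f /oe /eqP.
Qed.

Lemma uniq_map_inj_in (T T' : eqType) (h : T -> T') (s : seq T) :
  uniq (map h s) -> {in s &, injective h}.
Proof.
elim: s => //= z s IHs /andP[hz us] x y; rewrite !inE.
move=> /orP[/eqP->|xs] /orP[/eqP->|ys] E //; last exact: IHs.
  by move: hz; rewrite E map_f.
by move: hz; rewrite -E map_f.
Qed.

(** Expanding vectors in the basis shows that [U] preserves the form, first against basis vectors
    and then, by conjugate symmetry, in general. *)
Lemma onb_unitary s (U : 'End(H)) :
  onb s -> orthonormal dot (map U s) -> Defs.is_unitary dot U.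
Proof.
move=> os /orthonormalP[uU oU].
have iso1 x f : f \in s -> dot (U x) (U f) = dot x f.
  move=> fs; rewrite [in LHS](onb_expand x os) [in RHS](onb_expand x os).
  rewrite linear_sum !linear_sumlz; apply: eq_big_seq => e es.
  rewrite linearZ /= !dotZl [dot (U e) _]oU ?map_f // [dot e f](onb_in os) //.
  by rewrite (inj_in_eq (uniq_map_inj_in uU)).
have iso x y : dot (U x) (U y) = dot x y.
  rewrite dotC [in RHS]dotC; congr (_^*).
  rewrite [in LHS](onb_expand y os) [in RHS](onb_expand y os).
  rewrite linear_sum !linear_sumlz; apply: eq_big_seq => e es.
  by rewrite linearZ /= !dotZl [dot (U e) _]dotC iso1 // -dotC.
have UU : (adj dot U \o U)%VF = \1%VF.
  by apply/lfunP => x; apply: dot_inj => z; rewrite comp_lfunE -adjP iso id_lfunE.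
(* An isometry is injective, hence invertible in finite dimension, so the left inverse [adj dot U]
   is also a right inverse. *)
have kU : lker U == 0%VS.
  apply/lker0P => x y Exy; apply/eqP; rewrite -subr_eq0 -(dnorm_eq0 dot).
  by rewrite -iso linearB /= Exy subrr dot0l.
split=> //; have <- : (U^-1)%VF = adj dot U; last exact: lker0_compfV.
by rewrite -[LHS]comp_lfun1l -UU -comp_lfunA lker0_compfV // comp_lfun1r.
Qed.

(** * Maximal measurements as orthonormal bases *)

Definition meas s : {fset 'End(H)} := [fset Q in [seq ketbra e e | e <- s]]%fset.

Lemma measP s (Q : 'End(H)) :
  reflect (exists2 e, e \in s & Q = ketbra e e) (Q \in meas s).
Proof. by rewrite inE; apply: mapP. Qed.

Lemma eq_meas s t : s =i t -> meas s = meas t.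
Proof.
move=> st; apply/fsetP => Q.
by apply/measP/measP => -[e es ->]; exists e; rewrite // ?st // -st.
Qed.

Lemma meas_cons_phase k e s : `|k| = 1 -> meas (k *: e :: s) = meas (e :: s).
Proof. by move=> k1; rewrite /meas /= ketbra_phase. Qed.

Lemma conj_meas_meas U s : conj_meas dot U (meas s) = meas (map U s).
Proof.
apply/fsetP => Q; apply/imfsetP/measP => [[_ /measP[e es ->] ->]|[_ /mapP[e es ->] ->]].
  by exists (U e); rewrite ?map_f // ketbra_conj.
by exists (ketbra e e); rewrite ?ketbra_conj //=; apply/measP; exists e.
Qed.

(** Evaluating |e><e| = |f><f| at [e] gives e = <e, f> f, which would vanish for distinct basis
    vectors. *)
Lemma ketbra_inj_in s : onb s -> {in s &, injective (fun e => ketbra e e)}.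
Proof.
move=> os e f es fs /lfunP/(_ e); rewrite !ketbraE !(onb_in os) // eqxx scale1r.
by case: eqP => // _; rewrite scale0r => e0; move: (onb_in os es es);
  rewrite eqxx e0 dot0l => /esym/eqP; rewrite oner_eq0.
Qed.

Lemma meas_max s : onb s -> is_max_measurement dot (meas s).
Proof.
move=> os; have us e : e \in s -> dot e e = 1.
  by move=> es; rewrite (onb_in os) ?eqxx.
have r1 P : P \in meas s -> is_rank_one_proj dot P.
  by move=> /measP[e es ->]; apply/rank_one_ketbra/us.
split; last by move=> P /r1[].
split.
- move=> P Ps; have [oP dP] := r1 _ Ps; split=> //.
  apply: contra_eq_neq dP => ->.
  by rewrite lim0g dimv0.
- move=> P Q /measP[e es ->] /measP[f fs ->] nef; apply/lfunP => x.
  rewrite comp_lfunE !ketbraE dotZl [dot f e](onb_in os) // eq_sym.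
  rewrite (negPf (contra_neq _ nef)) => [|->//].
  by rewrite mulr0 scale0r zero_lfunE.
(* Injectivity of e -> |e><e| on the basis means that no term is lost in passing from the list to
   the set. *)
- have um : perm_eq (meas s) [seq ketbra e e | e <- s].
    apply: uniq_perm => [||Q]; rewrite ?fset_uniq ?inE //.
    rewrite map_inj_in_uniq; first by case: os => /orthonormalP[].
    exact: ketbra_inj_in.
  rewrite (perm_big _ um) big_map; apply/lfunP => x; rewrite id_lfunE sum_lfunE.
  by rewrite [RHS](onb_expand x os); apply: eq_bigr => e _; rewrite ketbraE.
Qed.

(** Converse of [meas_max], with the vector representing one member prescribed: one unit vector is
    chosen in the range of each member. *)
Lemma max_measP M p : is_max_measurement dot M -> dot p p = 1 ->
  ketbra p p \in M -> exists2 s, onb (p :: s) & M = meas (p :: s).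
Proof.
move=> [[pM oM sM] dM] p1 pM'.
have /choice[v0 vE0] : forall Q, exists e, Q \in M -> dot e e = 1 /\ Q = ketbra e e.
  move=> Q; case QM : (Q \in M); last by exists 0.
  have [|e e1 ->] := @rank_oneP Q; last by exists e.
  by split; [case: (pM Q)|exact: dM].
(* The choice is overridden at [ketbra p p], so that the basis contains [p] itself and not a phase
   multiple of it. *)
pose v Q := if Q == ketbra p p then p else v0 Q.
have vE Q : Q \in M -> dot (v Q) (v Q) = 1 /\ Q = ketbra (v Q) (v Q).
  by move=> QM; rewrite /v; case: eqP => [->|_] //; exact: vE0.
pose s0 := map v M.
have vinj : {in M &, injective v}.
  by move=> P Q PM QM E; rewrite (vE _ PM).2 E -(vE _ QM).2.
have os0 : onb s0.
  have oo : orthonormal dot s0.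
    apply/orthonormalP; split; first by rewrite map_inj_in_uniq ?fset_uniq.
    move=> _ _ /mapP[P PM ->] /mapP[Q QM ->].
    rewrite (inj_in_eq vinj) //; case: eqP => [->|/eqP nPQ].
      by have [] := vE Q QM.
    have [[P1 PE] [Q1 QE]] := (vE P PM, vE Q QM).
    (* Q P = 0 evaluated at [v P] reads <v P, v Q> v Q = 0, whence orthogonality. *)
    have := oM Q P QM PM; rewrite eq_sym => /(_ nPQ)/lfunP/(_ (v P)).
    have PvP : P (v P) = v P by rewrite {1}PE ketbraE P1 scale1r.
    have Qx x : Q x = dot x (v Q) *: v Q by rewrite {1}QE ketbraE.
    rewrite comp_lfunE PvP Qx zero_lfunE => /eqP.
    by rewrite scaler_eq0 (negPf (unit_neq0 Q1)) orbF => /eqP.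
  (* The members sum to the identity, so the chosen vectors span the space and their number is its
     dimension. *)
  split=> //; have /eqP <- := orthonormal_free oo.
  congr (\dim _); apply/eqP; rewrite eqEsubv subvf /=; apply/subvP => x _.
  have <- : \sum_(Q <- M) Q x = x by rewrite -sum_lfunE sM id_lfunE.
  rewrite big_seq; apply: rpred_sum => Q QM.
  by rewrite (vE _ QM).2 ketbraE memvZ // memv_span // map_f.
have ps0 : p \in s0 by apply/mapP; exists (ketbra p p); rewrite // /v eqxx.
have pe := perm_to_rem ps0.
exists (rem p s0); first exact: onb_perm pe os0.
rewrite -(eq_meas (perm_mem pe)); apply/fsetP => Q; apply/idP/measP.
  by move=> QM; exists (v Q); [exact: map_f|exact: (vE _ QM).2].
by move=> [_ /mapP[P PM ->] ->]; rewrite -(vE _ PM).2.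
Qed.

Lemma rank_one_mem (M : {fset 'End(H)}) P :
  max_meas_at dot P M -> is_rank_one_proj dot P.
Proof. by move=> [[[oM _ _] dM] PM]; split; [case: (oM P PM)|exact: dM]. Qed.

(** [U] carries a basis through [p] to a basis through U p = p. This keeps the values compared in
    [def2] within the domain of the assignment. *)
Lemma stab_conj_max (P U : 'End(H)) M :
  max_meas_at dot P M -> stab dot P U -> max_meas_at dot P (conj_meas dot U M).
Proof.
move=> MP [[UU _] UP]; have [p p1 EP] := rank_oneP (rank_one_mem MP).
have [mM PM] := MP.
have Up : U p = p by apply: UP; rewrite EP limg_ketbra ?memv_line.
rewrite EP in PM *; have [s os EM] := max_measP mM p1 PM.
rewrite EM conj_meas_meas; split; last first.
  by apply/measP; exists p => //=; rewrite inE Up eqxx.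
apply: meas_max; case: os => /orthonormalP[us oo] ss; split; last by rewrite size_map.
have iso x y : dot (U x) (U y) = dot x y by rewrite adjP -comp_lfunE UU id_lfunE.
have Uinj : injective U.
  by move=> x y /(congr1 (adj dot U)); rewrite -!comp_lfunE UU !id_lfunE.
apply/orthonormalP; split; first by rewrite map_inj_uniq.
by move=> _ _ /mapP[x xs ->] /mapP[y ys ->]; rewrite iso (inj_eq Uinj) oo.
Qed.

(** * Rotations of a plane *)

Definition rotation a b a' b' : 'End(H) :=
  (\1 - ketbra (a - a') a - ketbra (b - b') b)%VF.

Lemma rotationE a b a' b' x :
  rotation a b a' b' x = x - dot x a *: (a - a') - dot x b *: (b - b').
Proof. by rewrite /rotation !(add_lfunE, opp_lfunE) id_lfunE !ketbraE. Qed.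

Lemma map_rotation a b a' b' r : onb (a :: b :: r) ->
  map (rotation a b a' b') (a :: b :: r) = a' :: b' :: r.
Proof.
move=> os.
have [/orthonormalP[/= /and3P[]]] := os; rewrite inE => /norP[nab ar] br ur _ _.
have E e f : e \in a :: b :: r -> f \in a :: b :: r -> dot e f = (e == f)%:R.
  exact: onb_in.
rewrite !rotationE !E ?inE ?eqxx ?orbT // [b == a]eq_sym (negPf nab).
rewrite !scale0r !scale1r !subr0 !opprB !(addrC a, addrC b) !subrK.
congr [:: _, _ & _]; rewrite -[RHS]map_id; apply/eq_in_map => e er.
rewrite rotationE !E ?inE ?er ?eqxx ?orbT //.
by rewrite (negPf (memPn ar _ er)) (negPf (memPn br _ er)) !scale0r !subr0.
Qed.

(** The vectors of [r] are orthogonal to [a] and [b], hence to the whole plane containing [a'] and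
    [b']. *)
Lemma onb_replace_pair a b r a' b' : onb (a :: b :: r) ->
  a' \in <<[:: a; b]>>%VS -> b' \in <<[:: a; b]>>%VS ->
  orthonormal dot [:: a'; b'] -> onb (a' :: b' :: r).
Proof.
move=> [os ss] a'ab b'ab oab'; split; last by rewrite -ss.
move: os; rewrite -[a :: b :: r]/([:: a; b] ++ r) orthonormal_cat.
move=> /and3P[_ or /orthogonalP oabr].
rewrite -[a' :: b' :: r]/([:: a'; b'] ++ r) orthonormal_cat oab' or !andTb.
apply/orthogonalP => u v; rewrite !inE => uab vr.
have uab' : u \in <<[:: a; b]>>%VS by case/orP: uab => /eqP->.
apply: (@span_orthogonal _ _ dot [:: a; b] r) => //; last exact: memv_span.
exact/orthogonalP.
Qed.

(** Serves the degenerate case of alignment, where the target is a multiple of [a] and the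
    measurement does not change. *)
Lemma onb_scale k a r : onb (a :: r) -> dot (k *: a) (k *: a) = 1 ->
  onb (k *: a :: r) /\ meas (k *: a :: r) = meas (a :: r).
Proof.
move=> [/orthonormal_cons[a1 or ar] ss] k1.
split; last first.
  apply: meas_cons_phase; apply/eqP.
  by rewrite -(@eqrXn2 _ 2) // expr1n -k1 dnormZ a1 mulr1.
split=> //; apply/orthonormal_cons; split=> // e er.
by rewrite dotZl ar // mulr0.
Qed.

(** One Gram-Schmidt step: [g] is the normalized component of [f] orthogonal to [a], and [f']
    completes [f] in the plane of [a] and [g]. The last clause later yields that [g] is orthogonal
    to whatever both [f] and [a] are orthogonal to. *)
Lemma split_unit a f : dot a a = 1 -> dot f f = 1 -> f != dot f a *: a ->
  exists g f', [/\ dot g g = 1, f \in <<[:: a; g]>>%VS,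
    f' \in <<[:: a; g]>>%VS, orthonormal dot [:: f; f'] &
    exists k, g = k *: (f - dot f a *: a)].
Proof.
move=> a1 f1; rewrite -subr_eq0 => /normalize[k k0].
set k1 := dot f a; set g := _ *: _ => g1.
have ag : a \in <<[:: a; g]>>%VS by rewrite memv_span ?inE ?eqxx.
have gg : g \in <<[:: a; g]>>%VS by rewrite memv_span ?inE ?eqxx ?orbT.
have kC : k^* = k by apply: conj_Creal; rewrite ger0_real // ltW.
have ga : dot g a = 0 by rewrite dotZl dotBl dotZl a1 mulr1 subrr mulr0.
have Ef : f = k1 *: a + k *: g.
  by rewrite scalerA divff ?gt_eqF // scale1r addrC subrK.
have ga' : dot a g = 0 by rewrite dotC ga conjC0.
have Eg : exists c, g = c *: (f - k1 *: a) by exists k^-1.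
(* With f = k1 a + k g and k real, this second vector is orthogonal to [f]. *)
exists g, (k1^* *: g - k *: a); clearbody g k1; split=> //.
- by rewrite Ef memvD // memvZ.
- by rewrite memvB // memvZ.
apply/orthonormal2P; split=> //.
  rewrite Ef dotDl !dotBr !dotZl !dotZr g1 a1 ga ga' kC conjCK.
  by ring.
(* Both [f] and [f'] have squared norm |k1|^2 + k^2. *)
rewrite -[RHS]f1 [in RHS]Ef !(dotBl, dotBr, dotDl, dotDr, dotZl, dotZr) g1 a1 ga ga' kC conjCK.
by ring.
Qed.

(** * Counting two-level moves between bases. The bound [c] is kept abstract so as to serve for both
    [def2] and 0 *)

Section Bound.
Variables (w : 'End(H) -> {fset 'End(H)} -> R) (p : H) (c : R).
Hypothesis c_ge0 : 0 <= c.
Hypothesis move_le : forall M U, max_meas_at dot (ketbra p p) M ->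
  two_level_stab dot (ketbra p p) U ->
  `|w (ketbra p p) (conj_meas dot U M) - w (ketbra p p) M| <= c.

(** Depends only on the set of vectors of [s], so bases may be reordered at no cost. *)
Let W s := w (ketbra p p) (meas s).

(** Since [p] is in [r], it is orthogonal to [a] and [b]; the rotation therefore fixes [p], and the
    span of [a] and [b] witnesses that it is two-level. *)
Lemma two_level_move a b r a' b' : onb (a :: b :: r) -> p \in r ->
  a' \in <<[:: a; b]>>%VS -> b' \in <<[:: a; b]>>%VS ->
  orthonormal dot [:: a'; b'] ->
  `|W (a' :: b' :: r) - W (a :: b :: r)| <= c.
Proof.
move=> os pr a'ab b'ab oab'.
have os' := onb_replace_pair os a'ab b'ab oab'.
have mU := map_rotation a' b' os.
set U := rotation a b a' b' in mU.
have oo e : e \in a :: b :: r -> dot p e = (p == e)%:R.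
  by move=> es; rewrite (onb_in os) // !inE pr !orbT.
have [/orthonormalP[/= /and3P[]]] := os; rewrite inE => /norP[nab ar] br _ _ _.
have pa : dot p a = 0 by rewrite oo ?inE ?eqxx // (negPf (memPn ar _ pr)).
have pb : dot p b = 0 by rewrite oo ?inE ?eqxx ?orbT // (negPf (memPn br _ pr)).
have p1 : dot p p = 1 by rewrite oo ?eqxx // !inE pr !orbT.
rewrite /W -mU -conj_meas_meas; apply: move_le.
  by split; [exact: meas_max|apply/measP; exists p => //; rewrite !inE pr !orbT].
split.
  split; first by apply: (onb_unitary os); rewrite mU; case: os'.
  move=> x; rewrite limg_ketbra // => /vlineP[k ->].
  by rewrite linearZ /= rotationE pa pb !scale0r !subr0.
exists <<[:: a; b]>>%VS; split; last 1 first.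
- move=> x; rewrite memv_cap => /andP[_ /mem_orthovP xab].
  by rewrite rotationE !xab ?memv_span ?inE ?eqxx ?orbT // !scale0r !subr0.
- apply/span_subvP => e eab.
  apply/memv_imgP; exists e; rewrite ?memvf //.
  rewrite !(add_lfunE, opp_lfunE) id_lfunE ketbraE dotC.
  have -> : dot p e = 0 by move: eab; rewrite !inE => /orP[]/eqP->.
  by rewrite conjC0 scale0r subr0.
- exact: dim_span.
Qed.

(** The vectors of [r], among them [p], are frozen; those of [a :: s] may move. Induction on [s]:
    bring [g] into the basis with [a] frozen too, then rotate the plane of [a] and [g] to that of
    [f] and [f']. *)
Lemma align_vector s : forall a f r, onb (a :: s ++ r) -> p \in r ->
  orthonormal dot (f :: r) ->
  exists s', [/\ size s' = size s, onb (f :: s' ++ r) &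
    `|W (f :: s' ++ r) - W (a :: s ++ r)| <= c *+ size s].
Proof.
elim: s => [|b s IHs] a f r os pr /orthonormal_cons[f1 or fr].
all: have [/orthonormal_cons[a1 osr asr] ss] := os.
all: have [Ef|nf] := eqVneq f (dot f a *: a).
(* When [f] is a multiple of [a], with [s] empty or not, rescaling [a] suffices and [s] is kept. *)
1,3: have [|os' mE] := @onb_scale (dot f a) _ _ os; first by rewrite -Ef.
1,2: rewrite -Ef in os' mE; eexists; split; first reflexivity; rewrite // /W mE.
1,2: by rewrite subrr normr0 mulrn_wge0.
  (* With [s] empty, f - <f, a> a is orthogonal to the whole basis [a :: r], so the non-degenerate
     case is absurd. *)
  case/eqP: nf; apply/eqP; rewrite -subr_eq0; apply/eqP.
  apply: (onb_ortho0 os) => e; rewrite inE => /orP[/eqP->|er].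
    by rewrite dotBl dotZl a1 mulr1 subrr.
  by rewrite dotBl dotZl fr // asr // mulr0 subrr.
have [g [f' [g1 fag f'ag off' [k Eg]]]] := split_unit a1 f1 nf.
have oag : orthonormal dot (g :: a :: r).
  apply/orthonormal_cons; split=> //.
    apply/orthonormal_cons; split=> // e er.
    by rewrite asr // mem_cat er orbT.
  move=> e; rewrite Eg inE => /orP[/eqP->|er]; rewrite dotZl dotBl dotZl.
    by rewrite a1 mulr1 subrr mulr0.
  by rewrite fr // asr ?mem_cat ?er ?orbT // mulr0 subrr mulr0.
have pe1 : perm_eq (a :: (b :: s) ++ r) (b :: s ++ a :: r).
  by rewrite -[a :: _]cat1s -[a :: r]cat1s -cat_cons !catA perm_cat2r perm_catC.
have par : p \in a :: r by rewrite inE pr orbT.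
have [s' [ss' os' le']] := IHs b g _ (onb_perm pe1 os) par oag.
have pe2 : perm_eq (g :: s' ++ a :: r) (a :: g :: s' ++ r).
  by rewrite -[a :: r]cat1s -[a :: g :: _]cat1s -!cat_cons !catA perm_cat2r perm_catC.
have os2 := onb_perm pe2 os'.
have prs : p \in s' ++ r by rewrite mem_cat pr orbT.
exists (f' :: s'); split; first by rewrite /= ss'.
  exact: onb_replace_pair os2 _ _ _.
have le2 := two_level_move os2 prs fag f'ag off'.
move: le2 le'; rewrite /W (eq_meas (perm_mem pe1)) (eq_meas (perm_mem pe2)) /=.
by rewrite mulrS => le2 le'; apply: le_trans (ler_distD _ _ _) (lerD le2 le').
Qed.

(** Align the first vector of [t] at the cost of [size s] - 1 moves, freeze it, and recurse on the
    remaining vectors. *)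
Lemma connect_frames t : forall s r, onb (s ++ r) -> onb (t ++ r) -> p \in r ->
  `|W (t ++ r) - W (s ++ r)| <= c *+ 'C(size s, 2).
Proof.
elim: t => [|f t IHt] s r os ot pr.
  have -> : s = [::].
    apply/nilP; rewrite /nilp -(eqn_add2r (size r)) -size_cat os.2 -ot.2.
    by [].
  by rewrite subrr normr0.
have sz : size s = (size t).+1.
  by apply/eqP; rewrite -(eqn_add2r (size r)) -size_cat os.2 -ot.2 size_cat.
case: s => [//|a s] /= in os sz *; case: sz => sz.
have ofr : orthonormal dot (f :: r).
  have [f1 otr fr] := (orthonormal_cons _ _).1 ot.1.
  apply/orthonormal_cons; split=> // [|e er].
    by move: otr; rewrite orthonormal_cat => /and3P[].
  by rewrite fr // mem_cat er orbT.
have [s' [ss' os' le1]] := align_vector os pr ofr.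
have pe u : perm_eq (f :: u ++ r) (u ++ f :: r).
  by rewrite -[f :: u ++ r]cat1s -[f :: r]cat1s !catA perm_cat2r perm_catC.
have := IHt s' (f :: r) (onb_perm (pe _) os') (onb_perm (pe _) ot).
rewrite inE pr orbT => /(_ isT).
(* Pascal's rule C(m + 1, 2) = C(m, 2) + m splits the cost into the recursive part and the alignment
   just made. *)
rewrite /W -!(eq_meas (perm_mem (pe _))) ss' binS bin1 mulrnDr => le2.
by apply: le_trans (ler_distD _ _ _) (lerD le2 le1).
Qed.

End Bound.
End RankOne.

(** * Oscillation bound and equivalence of the invariances *)

Section Assignments.
Variables (R : realType) (H : vectType R[i]) (dot : {dot H for Num.conj}).
Variable w : 'End(H) -> {fset 'End(H)} -> R.

Lemma two_level_chain P c : 0 <= c ->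
  (forall M U, max_meas_at dot P M -> two_level_stab dot P U ->
    `|w P (conj_meas dot U M) - w P M| <= c) ->
  forall M N, max_meas_at dot P M -> max_meas_at dot P N ->
    `|w P M - w P N| <= c *+ 'C((\dim {:H}).-1, 2).
Proof.
move=> c0 wc M N PM PN; have [p p1 EP] := rank_oneP (rank_one_mem PM).
move: PM PN wc; rewrite EP => -[mM PM] [mN PN] wc.
have [s os ->] := max_measP mM p1 PM; have [t ot ->] := max_measP mN p1 PN.
have pe u : perm_eq (p :: u) (u ++ [:: p]) by rewrite -cat1s perm_catC.
rewrite !(eq_meas dot (perm_mem (pe _))).
have <- : size t = (\dim {:H}).-1 by rewrite -ot.2.
(* Initially only [p] is frozen, which leaves dim H - 1 movable vectors. *)
by apply: connect_frames; rewrite ?mem_seq1 //; apply: onb_perm (pe _) _.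
Qed.

Hypothesis w_assign : is_assignment dot w.

Lemma assignment_dist_le1 P M N :
  max_meas_at dot P M -> max_meas_at dot P N -> `|w P M - w P N| <= 1.
Proof.
move=> [mM PM] [mN PN].
have [/(_ P PM) wM _] := w_assign mM; have [/(_ P PN) wN _] := w_assign mN.
by rewrite ler_norml; lra.
Qed.

(** The set is bounded by 1, so its [sup] is a genuine upper bound. *)
Lemma def2_ub P M U : max_meas_at dot P M -> two_level_stab dot P U ->
  `|w P (conj_meas dot U M) - w P M| <= def2 dot P w.
Proof.
move=> PM PU; apply: ub_le_sup; last by exists M, U.
exists 1 => _ [N [V [PN [PV _] ->]]].
exact: assignment_dist_le1 (stab_conj_max PN PV) PN.
Qed.

Lemma def2_ge0 P : 0 <= def2 dot P w.
Proof.
rewrite /def2; set E := (X in sup X).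
(* If no maximal measurement contains [P], the set is empty and its [sup] is 0 by convention. *)
have [->|/set0P[r Er]] := eqVneq E set0; first by rewrite sup0.
have [M [U [PM PU Er']]] := Er.
by apply: le_trans (def2_ub PM PU).
Qed.

Lemma osc_max_le P : osc_max dot P w <= 'C((\dim {:H}).-1, 2)%:R * def2 dot P w.
Proof.
rewrite mulr_natl /osc_max; set E := (X in sup X).
have [->|/set0P E0] := eqVneq E set0; first by rewrite sup0 mulrn_wge0 ?def2_ge0.
apply: ge_sup E0 _ => _ [M [N [PM PN ->]]].
by apply: two_level_chain PM PN => [|M' U]; [exact: def2_ge0|exact: def2_ub].
Qed.

(** The chain of moves with c = 0. *)
Lemma two_level_context_independent :
  two_level_invariant dot w -> context_independent dot w.
Proof.
move=> tw M N P mM mN PM PN; apply/eqP; rewrite -subr_eq0 -normr_le0.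
rewrite -(mul0rn _ 'C((\dim {:H}).-1, 2)).
apply: two_level_chain => // M' U PM' PU.
by rewrite tw ?subrr ?normr0 //; apply: rank_one_mem PM'.
Qed.

Lemma context_independent_unitary :
  context_independent dot w -> unitary_invariant dot w.
Proof.
move=> cw M P U mM PM PU.
have [mUM PUM] := stab_conj_max (conj mM PM) PU.
exact: cw.
Qed.

Lemma unitary_two_level :
  unitary_invariant dot w -> two_level_invariant dot w.
Proof. by move=> uw P M U _ [mM PM] [PU _]; exact: uw. Qed.

End Assignments.

Unset Implicit Arguments.

Theorem theorem4p6 (R : realType) (H : vectType R[i])
    (dot : {dot H for Num.conj}) (d : nat) (dimH : \dim {:H} = d)
    (d_ge2 : (2 <= d)%N) (w : 'End(H) -> {fset 'End(H)} -> R)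
    (w_assign : is_assignment dot w) :
  (forall P : 'End(H), is_rank_one_proj dot P ->
     osc_max dot P w <= 'C(d.-1, 2)%:R * def2 dot P w)
  /\ (two_level_invariant dot w <-> unitary_invariant dot w)
  /\ (two_level_invariant dot w <-> context_independent dot w).
Proof.
split; first by move=> P _; rewrite -dimH; exact: osc_max_le.
(* Both equivalences follow from the cycle: two-level invariance, context independence, full
   invariance, two-level invariance. *)
have tc := @two_level_context_independent _ _ dot w.
have cu := @context_independent_unitary _ _ dot w.
have ut := @unitary_two_level _ _ dot w.
by split; [split=> [/tc/cu|/ut]|split=> [/tc|/cu/ut]].
Qed.
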